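(* Let $k\ge1$ and let $V=GF(2)^k$. If there is a unit vector $v\in\mathbb{C}^{2^k}$ such that the $4^k$ vectors $$X(a)Y(b)v,\qquad a,b\in V,$$ span $4^k$ pairwise distinct lines that are equiangular, then $k\in\{1,3\}$.
   Context: Index the standard basis of $\mathbb{C}^{2^k}$ by $V$: $\{e_u:u\in V\}$. The generalized Pauli matrices are the linear maps $X(a):e_u\mapsto e_{u+a}$ and $Y(a):e_u\mapsto(-1)^{u^Ta}e_u$ for $a\in V$. Lines spanned by unit vectors are equiangular if $|x^*y|^2$ is the same constant for all pairs of vectors $x,y$ spanning distinct lines of the set. *)

(* Defs.v *)
From mathcomp Require Import all_boot all_order all_algebra.

Set Implicit Arguments.
Unset Strict Implicit.
Unset Printing Implicit Defensive.

Import Order.TTheory GRing.Theory Num.Theory.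
Local Open Scope ring_scope.

Notation gf2vec k := 'cV['F_2]_k.

(* C^(2^k), with coordinates indexed by GF(2)^k.  The codomain is the regular
   module C^o because that is where vector.v finds the vectType structure
   (needed for subspaces) on finite functions. *)
Notation cspace C k := {ffun gf2vec k -> C^o}.

Section Pauli.
Variables (C : numClosedFieldType) (k : nat).
Implicit Types (a b u : gf2vec k) (x y : cspace C k).

Definition std_basis u : cspace C k := [ffun w => (w == u)%:R].

Definition hdot x y : C := \sum_u (x u : C)^* * (y u : C).

Definition unit_vector x : Prop := hdot x x = 1.

(* The linear extensions of e_u |-> e_(u + a) and e_u |-> (-1)^(u^T a) e_u;
   the exponent is the representative in {0, 1} of u^T a : 'F_2. *)
Definition pauliX a x : cspace C k := \sum_u x u *: std_basis (u + a).

Definition pauliY a x : cspace C k :=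
  \sum_u x u *: ((-1) ^+ (u^T *m a) 0 0 *: std_basis u).

Lemma std_basis_sum (f : gf2vec k -> cspace C k) u :
  \sum_w std_basis u w *: f w = f u.
Proof.
rewrite (bigD1 u) //= ffunE eqxx scale1r big1 ?addr0 // => w /negPf w_u.
by rewrite ffunE w_u scale0r.
Qed.

Lemma pauliX_basis a u : pauliX a (std_basis u) = std_basis (u + a).
Proof. exact: (std_basis_sum (fun w => std_basis (w + a))). Qed.

Lemma pauliY_basis a u :
  pauliY a (std_basis u) = (-1) ^+ (u^T *m a) 0 0 *: std_basis u.
Proof.
exact: (std_basis_sum (fun w => (-1) ^+ (w^T *m a) 0 0 *: std_basis w)).
Qed.

Lemma lin_ext_linear (f : gf2vec k -> cspace C k) :
  linear (fun x : cspace C k => \sum_u x u *: f u).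
Proof.
move=> c x y; rewrite scaler_sumr -big_split /=; apply: eq_bigr => u _.
by rewrite !ffunE scalerDl scalerA.
Qed.

Lemma pauliX_linear a : linear (pauliX a).
Proof. exact: (lin_ext_linear (fun u => std_basis (u + a))). Qed.

Lemma pauliY_linear a : linear (pauliY a).
Proof.
exact: (lin_ext_linear (fun u => (-1) ^+ (u^T *m a) 0 0 *: std_basis u)).
Qed.

Definition pauli_line (v : cspace C k) (ab : gf2vec k * gf2vec k) :
    {vspace cspace C k} :=
  <[pauliX ab.1 (pauliY ab.2 v)]>%VS.

(* The value |x^* y|^2 depends only on the lines, unit spanning vectors being
   unique up to a scalar of modulus 1. *)
Definition equiangular (L : {pred {vspace cspace C k}}) : Prop :=
  exists c : C, forall x y, unit_vector x -> unit_vector y ->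
    <[x]>%VS \in L -> <[y]>%VS \in L -> <[x]>%VS != <[y]>%VS ->
    `|hdot x y| ^+ 2 = c.

End Pauli.

(* Main.v *)
(* Put d = 2^k and let P = v v^* be the projection on v.  The coefficients <v, X(a) Y(b) v> with
   (a, b) != (0, 0) have modulus 1/s, where s = sqrt (d + 1), and are real or purely imaginary
   because X(a) Y(b) is real and symmetric or antisymmetric.  Hence d P = 1 + S / s with S a
   matrix of Gaussian integers.  As P has rank one, P_uu P_ww = |P_uw|^2, which for u <> w gives
   s (S_uu + S_ww) an integer.  Either some S_uu + S_ww is nonzero, so that s is rational,
   2^k + 1 is a square and k = 3; or all of them vanish, and then Tr S = 0 yields
   (d - 2) S_uu = 0 for all u, while S_uu = 0 for all u would make <v, Y(b) v> vanish. *)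
Require Import Defs.
From mathcomp Require Import all_boot all_order all_algebra.
From mathcomp Require Import complex reals.
From mathcomp Require Import ring zify.

Set Implicit Arguments.
Unset Strict Implicit.
Unset Printing Implicit Defensive.

Import Order.TTheory GRing.Theory Num.Theory.
Local Open Scope ring_scope.

(** * Arithmetic: when $2^k+1$ is a square, and when its square root is rational *)

Lemma pow2_succ_square (k m : nat) : (2 ^ k + 1 = m ^ 2)%N -> k = 3%N.
Proof.
case: m => [|m]; first by rewrite addn1.
move=> km.
(* The root is now [m.+1], so $2^k = m(m+2)$: both factors are powers of 2, and they differ by 2,
   which leaves only 2 and 4. *)
have e2k : (2 ^ k = m * m.+2)%N by move: km; rewrite -mulnn; lia.
have [i _ mi] : exists2 i, (i <= k)%N & (m = 2 ^ i)%N.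
  by apply/(dvdn_pfactor _ _ (isT : prime 2)); rewrite e2k dvdn_mulr.
have [j _ mj] : exists2 j, (j <= k)%N & (m.+2 = 2 ^ j)%N.
  by apply/(dvdn_pfactor _ _ (isT : prime 2)); rewrite e2k dvdn_mull.
case: i mi => [|[|i]] mi; case: j mj => [|[|j]] mj;
  rewrite ?expn0 ?expn1 ?expnS in mi mj; try lia.
have m2 : m = 2%N by rewrite mi.
move: e2k; rewrite m2 -[(2 * 4)%N]/(2 ^ 3)%N => /eqP.
by rewrite eqn_exp2l // => /eqP.
Qed.

(** Squaring gives $n x^2 = y^2$ over the integers, so $x$ divides $y$ and $n$ is the square of the
    quotient. *)
Lemma sqrt_int_ratio (C : numFieldType) (n : nat) (s : C) (x y : int) :
  s ^+ 2 = n%:R -> s * x%:~R = y%:~R -> x != 0 -> exists m, n = (m ^ 2)%N.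
Proof.
move=> s2 sxy x0.
have exy : (n * `|x| ^ 2 = `|y| ^ 2)%N.
  have : (n%:Z * x ^+ 2)%:~R = (y ^+ 2)%:~R :> C.
    by rewrite rmorphM /= !rmorphXn /= -sxy exprMn s2.
  move/intr_inj/(congr1 absz).
  by rewrite abszM !abszX absz_nat.
have /dvdnP[m ym] : (`|x| %| `|y|)%N.
  by rewrite -(dvdn_pexp2r _ _ (isT : (0 < 2)%N)) -exy dvdn_mull.
exists m; apply/eqP; rewrite -(@eqn_pmul2r (`|x| ^ 2)) ?expn_gt0 ?absz_gt0 ?x0 //.
by rewrite exy ym expnMn.
Qed.

(** * Gaussian integers *)

Definition gaussian_int (C : numClosedFieldType) (z : C) : Prop :=
  exists x y : int, z = x%:~R + 'i * y%:~R.

Lemma gaussian_int_sum (C : numClosedFieldType) (I : finType) (P : pred I) (F : I -> C) :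
  (forall i, P i -> gaussian_int (F i)) -> gaussian_int (\sum_(i | P i) F i).
Proof.
move=> FP; apply: big_ind => //.
  by exists 0, 0; rewrite mulr0 addr0.
move=> _ _ [x [y ->]] [x' [y' ->]]; exists (x + x'), (y + y').
by rewrite !rmorphD /=; ring.
Qed.

Lemma gaussian_int_signM (C : numClosedFieldType) (n : nat) (z : C) :
  gaussian_int z -> gaussian_int ((-1) ^+ n * z).
Proof.
move=> [x [y ->]]; exists ((-1) ^+ n * x), ((-1) ^+ n * y).
by rewrite !rmorphM /= rmorph_sign; ring.
Qed.

(** Such a $z$ is one of $\pm 1, \pm i$. *)
Lemma gaussian_int_unit (C : numClosedFieldType) (n : nat) (z : C) :
  z ^+ 2 = (-1) ^+ n -> gaussian_int z.
Proof.
rewrite -signr_odd; case: (odd n) => /= /eqP.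
  rewrite expr1 -sqrCi eqf_sqr => /orP[]/eqP->.
    by exists 0, 1; rewrite mulr1 add0r.
  by exists 0, (-1); rewrite rmorphN mulrN1 add0r.
rewrite expr0 sqrf_eq1 => /orP[]/eqP->.
  by exists 1, 0; rewrite mulr0 addr0.
by exists (-1), 0; rewrite mulr0 addr0 rmorphN.
Qed.

Lemma gaussian_int_real (C : numClosedFieldType) (z : C) :
  z \is Num.real -> gaussian_int z -> exists m : int, z = m%:~R.
Proof.
move=> zR [x [y zE]]; exists x.
by rewrite -(Creal_ReP _ zR) zE Re_rect ?realz.
Qed.

Lemma gaussian_int_norm (C : numClosedFieldType) (z : C) :
  gaussian_int z -> exists m : int, `|z| ^+ 2 = m%:~R.
Proof.
move=> [x [y ->]]; exists (x ^+ 2 + y ^+ 2).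
by rewrite normC2_rect ?realz // rmorphD !rmorphXn.
Qed.

(** * Characters of $V$ and Fourier analysis on $V$ *)

Definition pauli_char (C : numClosedFieldType) (k : nat) (b u : gf2vec k) : C :=
  (-1) ^+ (u^T *m b) 0 0.

Lemma sign_F2D (C : numClosedFieldType) (x y : 'F_2) :
  (-1) ^+ (x + y)%R = (-1) ^+ x * (-1) ^+ y :> C.
Proof.
by case: x y => [[|[|x]] hx] [[|[|y]] hy] //=;
  rewrite ?expr0 ?expr1 ?mulr1 ?mul1r // mulrNN mulr1.
Qed.

Lemma pauli_char0 (C : numClosedFieldType) (k : nat) (u : gf2vec k) :
  pauli_char C 0 u = 1.
Proof. by rewrite /pauli_char mulmx0 mxE expr0. Qed.

Lemma pauli_charDr (C : numClosedFieldType) (k : nat) (b u w : gf2vec k) :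
  pauli_char C b (u + w) = pauli_char C b u * pauli_char C b w.
Proof. by rewrite /pauli_char linearD mulmxDl mxE sign_F2D. Qed.

Lemma pauli_charDl (C : numClosedFieldType) (k : nat) (b c u : gf2vec k) :
  pauli_char C (b + c) u = pauli_char C b u * pauli_char C c u.
Proof. by rewrite /pauli_char mulmxDr mxE sign_F2D. Qed.

Lemma pauli_charC (C : numClosedFieldType) (k : nat) (b u : gf2vec k) :
  pauli_char C b u = pauli_char C u b.
Proof. by rewrite /pauli_char -[b in LHS]trmxK -trmx_mul mxE. Qed.

Lemma pauli_char_conj (C : numClosedFieldType) (k : nat) (b u : gf2vec k) :
  (pauli_char C b u)^* = pauli_char C b u.
Proof. by rewrite rmorph_sign. Qed.

Lemma pauli_char_sqr (C : numClosedFieldType) (k : nat) (b u : gf2vec k) :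
  pauli_char C b u ^+ 2 = 1.
Proof. exact: sqrr_sign. Qed.

Lemma gf2vec_addxx (k : nat) (a : gf2vec k) : a + a = 0.
Proof.
by apply/colP=> i; rewrite !mxE (addrr_pchar2 (pchar_Fp (isT : prime 2))).
Qed.

Lemma gf2vec_addK (k : nat) (a : gf2vec k) : involutive (+%R^~ a).
Proof. by move=> u; rewrite -addrA gf2vec_addxx addr0. Qed.

Lemma card_gf2vec (k : nat) : #|{: gf2vec k}| = (2 ^ k)%N.
Proof. by rewrite card_mx card_Fp // muln1. Qed.

Lemma pauli_char_nontrivial (C : numClosedFieldType) (k : nat) (u : gf2vec k) :
  u != 0 -> exists b : gf2vec k, pauli_char C b u = -1.
Proof.
case/matrix0Pn => i [j uij]; exists (delta_mx i 0).
have -> : pauli_char C (delta_mx i 0) u = (-1) ^+ (u i 0).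
  by rewrite /pauli_char -colE !mxE.
by move: uij; rewrite ord1; case: (u i 0) => [[|[|x]] hx].
Qed.

(** For $u \ne 0$ some $c$ has character value $-1$ at $u$; translating the index $b$ by $c$ negates
    the sum. *)
Lemma pauli_char_sum (C : numClosedFieldType) (k : nat) (u : gf2vec k) :
  \sum_b pauli_char C b u = (2 ^ k)%:R *+ (u == 0).
Proof.
case: eqVneq => [->|u0] /=.
  rewrite (eq_bigr (fun=> 1)) => [|b _]; last by rewrite pauli_charC pauli_char0.
  by rewrite sumr_const card_gf2vec.
have [c cu] := pauli_char_nontrivial C u0.
have : \sum_b pauli_char C b u = - \sum_b pauli_char C b u.
  rewrite [LHS](reindex_inj (inv_inj (gf2vec_addK c))) -sumrN.
  by apply: eq_bigr => b _; rewrite pauli_charDl cu mulrN1.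
by move=> /eqP; rewrite -addr_eq0 -mulr2n mulrn_eq0 /= => /eqP.
Qed.

Lemma pauli_char_ortho (C : numClosedFieldType) (k : nat) (u w : gf2vec k) :
  \sum_b pauli_char C b u * pauli_char C b w = (2 ^ k)%:R *+ (u == w).
Proof.
rewrite (eq_bigr (fun b => pauli_char C b (u + w))) => [|b _]; last first.
  by rewrite pauli_charDr.
by rewrite pauli_char_sum -[u == w](inj_eq (inv_inj (gf2vec_addK w))) gf2vec_addxx.
Qed.

Lemma fourier_inversion (C : numClosedFieldType) (k : nat)
    (f : gf2vec k -> C) (u : gf2vec k) :
  \sum_b pauli_char C b u * (\sum_w pauli_char C b w * f w) = (2 ^ k)%:R * f u.
Proof.
under eq_bigr do rewrite mulr_sumr.
rewrite exchange_big (bigD1 u) //= [X in _ + X]big1 ?addr0 => [|w wu].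
  by under eq_bigr do rewrite mulrA; rewrite -mulr_suml pauli_char_ortho eqxx.
under eq_bigr do rewrite mulrA.
by rewrite -mulr_suml pauli_char_ortho eq_sym (negPf wu) mul0r.
Qed.

(** Expand only the conjugate factor of each squared modulus; after exchanging the sums, Fourier
    inversion evaluates the rest. *)
Lemma parseval (C : numClosedFieldType) (k : nat) (f : gf2vec k -> C) :
  \sum_b `|\sum_w pauli_char C b w * f w| ^+ 2 = (2 ^ k)%:R * \sum_u `|f u| ^+ 2.
Proof.
transitivity (\sum_b \sum_u (f u)^* * (pauli_char C b u * \sum_w pauli_char C b w * f w)).
  apply: eq_bigr => b _; rewrite normCK mulrC rmorph_sum mulr_suml.
  by apply: eq_bigr => u _; rewrite rmorphM /= pauli_char_conj; ring.
rewrite exchange_big mulr_sumr; apply: eq_bigr => u _.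
by rewrite -mulr_sumr fourier_inversion normCK; ring.
Qed.

(** * The Pauli matrices in coordinates and the coefficients of $v$ *)

Lemma pauliXE (C : numClosedFieldType) (k : nat) (a : gf2vec k) (x : cspace C k) w :
  pauliX a x w = x (w + a).
Proof.
rewrite /pauliX sum_ffunE (bigD1 (w + a)) //= big1 ?addr0 => [|u uw].
  by rewrite !ffunE gf2vec_addK eqxx; exact: mulr1.
rewrite !ffunE -[w](gf2vec_addK a) (inj_eq (inv_inj (gf2vec_addK a))).
by rewrite eq_sym (negPf uw) scaler0.
Qed.

Lemma pauliYE (C : numClosedFieldType) (k : nat) (b : gf2vec k) (x : cspace C k) w :
  pauliY b x w = pauli_char C b w * x w.
Proof.
rewrite /pauliY sum_ffunE (bigD1 w) //= big1 ?addr0 => [|u uw].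
  by rewrite !ffunE eqxx /= [RHS]mulrC; congr (_ * _); exact: mulr1.
by rewrite !ffunE eq_sym (negPf uw) !scaler0.
Qed.

(** This is $v^* X(a) Y(b) v$, written so that for fixed $a$ it is a Fourier transform in $b$. *)
Definition pauli_coef (C : numClosedFieldType) (k : nat) (v : cspace C k)
    (a b : gf2vec k) : C :=
  \sum_u pauli_char C b u * ((v (u + a))^* * v u).

Lemma hdot_pauli (C : numClosedFieldType) (k : nat) (v : cspace C k)
    (a b : gf2vec k) :
  hdot v (pauliX a (pauliY b v)) = pauli_coef v a b.
Proof.
rewrite /hdot (reindex_inj (inv_inj (gf2vec_addK a))).
by apply: eq_bigr => u _; rewrite pauliXE pauliYE gf2vec_addK; ring.
Qed.

Lemma unit_vector_pauli (C : numClosedFieldType) (k : nat) (v : cspace C k)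
    (a b : gf2vec k) :
  unit_vector v -> unit_vector (pauliX a (pauliY b v)).
Proof.
rewrite /unit_vector => <-; rewrite /hdot [RHS](reindex_inj (inv_inj (gf2vec_addK a))).
apply: eq_bigr => u _; rewrite pauliXE pauliYE rmorphM /= pauli_char_conj.
by rewrite mulrACA -expr2 pauli_char_sqr mul1r.
Qed.

(** The shift $u \mapsto u + a$ swaps the two entries of $v$ and pulls out the sign
    [pauli_char C b a]. So each coefficient is real or purely imaginary. *)
Lemma pauli_coef_conj (C : numClosedFieldType) (k : nat) (v : cspace C k)
    (a b : gf2vec k) :
  (pauli_coef v a b)^* = pauli_char C b a * pauli_coef v a b.
Proof.
rewrite rmorph_sum mulr_sumr /= (reindex_inj (inv_inj (gf2vec_addK a))).
apply: eq_bigr => u _.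
by rewrite !rmorphM /= conjCK gf2vec_addK pauli_char_conj pauli_charDr; ring.
Qed.

(** Compare every line with the one of index $(0,0)$, which is spanned by $v$ itself. *)
Lemma pauli_coef_equiangular (C : numClosedFieldType) (k : nat) (v : cspace C k) :
  unit_vector v -> injective (pauli_line v) ->
  equiangular [in codom (pauli_line v)] ->
  exists c : C, forall a b, (a, b) != (0, 0) -> `|pauli_coef v a b| ^+ 2 = c.
Proof.
move=> vU inj [c hc]; exists c => a b ab0.
have v00 : pauliX 0 (pauliY 0 v) = v.
  by apply/ffunP => u; rewrite pauliXE pauliYE addr0 pauli_char0 mul1r.
have line0 : pauli_line v (0, 0) = <[v]>%VS by rewrite /pauli_line v00.
rewrite -hdot_pauli; apply: hc => //; first exact: unit_vector_pauli.
- by rewrite -line0; exact: codom_f.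
- exact: (codom_f (pauli_line v) (a, b)).
- by rewrite -line0 -[X in _ != X]/(pauli_line v (a, b)) (inj_eq inj) eq_sym.
Qed.

Lemma unit_vector_normsum (C : numClosedFieldType) (k : nat) (v : cspace C k) :
  unit_vector v -> \sum_u `|v u : C| ^+ 2 = 1.
Proof.
by move=> <-; apply: eq_bigr => u _; rewrite normCK mulrC.
Qed.

(** Parseval in $b$ leaves $2^k \sum_{a,u} |v_{u+a}|^2 |v_u|^2$, and this double sum factors as
    $\|v\|^4 = 1$. *)
Lemma pauli_coef_normsum (C : numClosedFieldType) (k : nat) (v : cspace C k) :
  unit_vector v ->
  \sum_a \sum_b `|pauli_coef v a b| ^+ 2 = (2 ^ k)%:R.
Proof.
move=> vU.
under eq_bigr do rewrite parseval.
rewrite -mulr_sumr exchange_big /= -[RHS]mulr1; congr (_ * _).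
rewrite -(unit_vector_normsum vU); apply: eq_bigr => u _.
under eq_bigr do rewrite normrM exprMn norm_conjC.
rewrite -mulr_suml -[RHS]mul1r; congr (_ * _).
by rewrite -(unit_vector_normsum vU) [RHS](reindex_inj (addrI u)).
Qed.

Lemma pauli_coef00 (C : numClosedFieldType) (k : nat) (v : cspace C k) :
  unit_vector v -> pauli_coef v 0 0 = 1.
Proof.
by move=> <-; apply: eq_bigr => u _; rewrite addr0 pauli_char0 mul1r.
Qed.

(** With $d = 2^k$, the sum of all squared moduli reads $1 + (d^2-1)c = d$; divide by $d - 1$,
    nonzero since $k \ge 1$. *)
Lemma equiangular_constant (C : numClosedFieldType) (k : nat) (v : cspace C k) (c : C) :
  (1 <= k)%N -> unit_vector v ->
  (forall a b, (a, b) != (0, 0) -> `|pauli_coef v a b| ^+ 2 = c) ->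
  (2 ^ k).+1%:R * c = 1.
Proof.
move=> k1 vU hc.
have := pauli_coef_normsum vU.
rewrite pair_bigA /= (bigD1 (0, 0)) //= pauli_coef00 // normr1 expr1n.
rewrite (eq_bigr (fun=> c)) => [|[a b] /= ab0]; last exact: hc.
have d1 : (1 < 2 ^ k)%N by rewrite -{1}(expn0 2) ltn_exp2l.
rewrite sumr_const cardC1 card_prod card_gf2vec => e.
have d1' : (2 ^ k)%:R - 1 != 0 :> C.
  by rewrite subr_eq0 pnatr_eq1 neq_ltn d1 orbT.
apply: (mulfI d1'); rewrite mulr1 -[in RHS]e [RHS]addrAC subrr add0r.
rewrite -[RHS]mulr_natl mulrA.
congr (_ * _).
rewrite -subn1 natrB ?muln_gt0 ?expn_gt0 // natrM -[(2 ^ k).+1]addn1 natrD; ring.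
Qed.

(** * Integrality of the entries of $S$ *)

Lemma scaled_coef_gaussian (C : numClosedFieldType) (k : nat) (v : cspace C k)
    (a b : gf2vec k) (s : C) :
  s \is Num.real -> `|s * pauli_coef v a b| ^+ 2 = 1 ->
  gaussian_int (s * pauli_coef v a b).
Proof.
move=> sR n1; apply: (@gaussian_int_unit _ ((a^T *m b) 0 0)).
rewrite -[RHS]/(pauli_char C b a).
move: n1; rewrite normCK rmorphM /= (CrealP sR) pauli_coef_conj => n1.
have := pauli_char_sqr C b a => x2.
by rewrite -[RHS]mulr1 -n1 -[LHS]mul1r -x2; ring.
Qed.

(** Fourier inversion at $a = u + w \ne 0$ gives a signed sum of coefficients that never meets the
    index $(0,0)$. *)
Lemma offdiag_gaussian (C : numClosedFieldType) (k : nat) (v : cspace C k)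
    (s : C) (u w : gf2vec k) :
  (forall a b, (a, b) != (0, 0) -> gaussian_int (s * pauli_coef v a b)) ->
  u != w -> gaussian_int (s * ((2 ^ k)%:R * ((v w)^* * v u))).
Proof.
move=> sG uw; have -> : w = u + (u + w) by rewrite addrA gf2vec_addxx add0r.
rewrite -(fourier_inversion (fun u' => (v (u' + (u + w)))^* * v u')) mulr_sumr.
apply: gaussian_int_sum => b _; rewrite mulrCA; apply: gaussian_int_signM.
apply: sG; apply: contraNneq uw => -[/eqP uw0 _].
by rewrite -[u](gf2vec_addK w) (eqP uw0) add0r.
Qed.

(** Inversion at $a = 0$; the subtracted 1 is the term $b = 0$, the only coefficient not covered by
    the hypothesis. *)
Lemma diag_gaussian (C : numClosedFieldType) (k : nat) (v : cspace C k)
    (s : C) (u : gf2vec k) :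
  unit_vector v ->
  (forall a b, (a, b) != (0, 0) -> gaussian_int (s * pauli_coef v a b)) ->
  gaussian_int (s * ((2 ^ k)%:R * `|v u : C| ^+ 2 - 1)).
Proof.
move=> vU sG.
have -> : `|v u : C| ^+ 2 = (v (u + 0))^* * v u by rewrite addr0 normCK mulrC.
rewrite -(fourier_inversion (fun u' => (v (u' + 0))^* * v u')) (bigD1 0) //=.
rewrite -/(pauli_coef v 0 0) pauli_coef00 // pauli_char0 mulr1 addrAC subrr add0r.
rewrite mulr_sumr; apply: gaussian_int_sum => b b0; rewrite mulrCA.
by apply: gaussian_int_signM; apply: sG; apply: contraNneq b0 => -[->].
Qed.

Lemma fiducial_dimension (C : numClosedFieldType) (k : nat) (v : cspace C k) :
  (1 <= k)%N -> unit_vector v -> injective (pauli_line v) ->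
  equiangular [in codom (pauli_line v)] -> k = 1%N \/ k = 3%N.
Proof.
move=> k1 vU inj /(pauli_coef_equiangular vU inj)[c hc].
have dc := equiangular_constant k1 vU hc.
pose d : C := (2 ^ k)%:R; pose s : C := sqrtC (2 ^ k).+1%:R.
have s2 : s ^+ 2 = (2 ^ k).+1%:R by rewrite sqrtCK.
have sR : s \is Num.real by rewrite ger0_real // sqrtC_ge0 ler0n.
have dR : d \is Num.real by rewrite realn.
have sG a b : (a, b) != (0, 0) -> gaussian_int (s * pauli_coef v a b).
  move=> ab0; apply: scaled_coef_gaussian => //.
  by rewrite normrM exprMn hc // real_normK // s2.
(* [s * f u] is the diagonal entry $S_{uu}$, and [m u] below is its integer value. *)
pose f u : C := d * `|v u : C| ^+ 2 - 1.
have fint u : exists m : int, s * f u = m%:~R.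
  apply: gaussian_int_real; last by apply: diag_gaussian.
  by rewrite rpredM // rpredB ?rpred1 // rpredM // rpredX // normr_real.
have [m sm] : exists m : gf2vec k -> int, forall u, s * f u = (m u)%:~R.
  exact: (@fin_all_exists _ (fun=> int) (fun u m => s * f u = m%:~R)).
have [|/forallPn[u /forallPn[w]]] :=
    boolP [forall u, forall w, (u != w) ==> (m u + m w == 0)]; last first.
  rewrite negb_imply => /andP[uw muw]; right.
  have [N NE] := gaussian_int_norm (offdiag_gaussian sG uw).
  (* Rank one: $N = |s d \bar v_w v_u|^2 = s^2 (1 + f_u)(1 + f_w)$; expand and substitute $s f =
     m$. *)
  have sm_int : s * (m u + m w)%:~R = (N - (2 ^ k).+1%:Z - m u * m w)%:~R.
    rewrite !rmorphB rmorphD rmorphM /= -!sm -NE -pmulrn -s2.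
    rewrite !normrM !exprMn norm_conjC -/d (real_normK sR) (real_normK dR) /f; ring.
  have [n nE] := sqrt_int_ratio s2 sm_int muw.
  by apply: (@pow2_succ_square _ n); rewrite addn1.
move=> h; left.
have s0 : s != 0 by rewrite sqrtC_eq0 pnatr_eq0.
have ff u w : u != w -> f u + f w = 0.
  move=> uw; apply: (mulfI s0); rewrite mulr0 mulrDr !sm -rmorphD.
  by move/forallP/(_ u)/forallP/(_ w)/implyP/(_ uw)/eqP: h => ->.
have fsum : \sum_u f u = 0.
  rewrite sumrB -mulr_sumr unit_vector_normsum // sumr_const card_gf2vec.
  by rewrite mulr1 subrr.
(* Summing over $w \ne u$ gives $(d-1) f_u + \sum_{w \ne u} f_w$, and the last sum is $-f_u$ by
   [fsum]. *)
have f2 u : (d - 2) * f u = 0.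
  have : \sum_(w | w != u) (f u + f w) = 0.
    by apply: big1 => w wu; rewrite ff // eq_sym.
  rewrite big_split /= sumr_const cardC1 card_gf2vec.
  move: fsum; rewrite (bigD1 u) //= => /eqP; rewrite addrC addr_eq0 => /eqP->.
  have -> : d - 2 = (2 ^ k).-1%:R - 1.
    by rewrite -subn1 natrB ?expn_gt0 // /d; ring.
  by rewrite mulrBl mul1r mulr_natl.
have [d2|d2] := eqVneq (d - 2) 0.
  move/eqP: d2; rewrite subr_eq0 eqr_nat -[2%N in X in _ == X](expn1 2) eqn_exp2l //.
  by move/eqP.
have f0 u : d * `|v u : C| ^+ 2 = 1.
  by move: (f2 u) => /eqP; rewrite mulf_eq0 (negPf d2) /= subr_eq0 => /eqP.
(* Now $|v_u|^2 = 1/d$ for all $u$, so for any $b \ne 0$ the coefficient at $(0,b)$ is a vanishing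
   character sum, whereas [dc] makes $c$ nonzero. *)
pose b : gf2vec k := const_mx 1.
have b0 : b != 0.
  by apply/matrix0Pn; exists (Ordinal k1), 0; rewrite mxE oner_eq0.
have : d * pauli_coef v 0 b = 0.
  have := pauli_char_sum C b; rewrite (negPf b0) mulr0n => <-.
  rewrite /pauli_coef mulr_sumr; apply: eq_bigr => u _.
  by rewrite addr0 [_^* * _]mulrC -normCK mulrCA f0 mulr1 pauli_charC.
have d0 : d != 0 by rewrite pnatr_eq0 expn_eq0.
move/eqP; rewrite mulf_eq0 (negPf d0) /= => /eqP q0.
have ab0 : (0, b) != (0, 0) :> gf2vec k * gf2vec k by apply: contraNneq b0 => -[->].
by move: dc; rewrite -(hc _ _ ab0) q0 normr0 expr0n mulr0 => /eqP;
  rewrite eq_sym oner_eq0.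
Qed.

Local Open Scope complex_scope.

Theorem lemma6p3p2 (R : realType) (k : nat) (hk : (1 <= k)%N) :
  (exists v : cspace R[i] k,
     [/\ unit_vector v,
         injective (pauli_line v)
       & equiangular [in codom (pauli_line v)]]) ->
  k = 1%N \/ k = 3%N.
Proof.
by move=> [v [vU inj eqv]]; exact: (fiducial_dimension hk vU inj eqv).
Qed.
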